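(* Let $d\ge1$, $\lambda>0$, and let $f_0:\mathbb{R}^d\to[0,\infty)$ be a probability density satisfying: (i) $f_0$ is continuous and $\lim_{\|x\|\to\infty}f_0(x)=0$; (ii) there are constants $C,\bar\epsilon>0$ with $\int_{\{x:|f_0(x)-\lambda|\le\epsilon\}}f_0(x)\,dx\le C\epsilon$ for all $\epsilon\in(0,\bar\epsilon)$; (iii) for any $\lambda_l<\lambda_h$ in $[\lambda-\bar\epsilon,\lambda+\bar\epsilon]$ and $x,y\in S_{\lambda_h}$: if $x,y$ lie in different connected components of $S_{\lambda_h}$ then they lie in different connected components of $S_{\lambda_l}$, and if $x,y$ lie in the same connected component of $S_{\lambda_l}$ then they lie in the same connected component of $S_{\lambda_h}$. Suppose further that $f_0$ is $\alpha$-H\''older continuous for some $\alpha\in(0,1]$, that $\mathcal{X}_n=\{x_1,\dots,x_n\}$ are drawn independently from $f_0$ with $n\ge16$, and that $D=\binom n2^{-1}L$ where $L$ is the Inactive/Active Binder loss with constants $0<a\le1$, $0<m\le1$, $a\le 2m$. Then there are finite constants $C_0,\bar\delta,\bar\gamma>0$, depending on $f_0$ (and $\lambda$), such that with probability at least $1-\frac{1+n}{n^2}$, $$\sup_{f:\|f-f_0\|_\infty\le\gamma} D\{\tilde\psi_{\lambda,\delta}(f),\psi_\lambda(f_0)\}\le C_0\Big\{\max(\gamma,\delta^\alpha)+\sqrt{\tfrac{\ln n}{n}}\Big\}$$ holds simultaneously for all $\delta\in[r_{n,\lambda,d},\bar\delta)$ and all $\gamma\in(0,\bar\gamma)$, where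 $r_{n,\lambda,d}=2\big(\frac{16\,d\ln n}{\lambda v_d n}\big)^{1/d}$ and $v_d$ is the volume of the unit Euclidean ball in $\mathbb{R}^d$.
   Context: $S_t=\{x\in\mathbb{R}^d:f_0(x)\ge t\}$ denotes the level-$t$ set of $f_0$; connectivity refers to topological connected components. A sub-partition of $\mathcal{X}_n$ is a collection of non-empty pairwise disjoint subsets of $\mathcal{X}_n$ (union possibly proper); its active set is the union, the rest are inactive points, and its allocation vector $c$ has $c_i=h$ if $x_i\in C_h$, $c_i=0$ if $x_i$ inactive. The level-$\lambda$ clustering $\psi_\lambda(f_0)$ is the sub-partition of $\mathcal{X}_n$ consisting of the non-empty sets $W\cap\mathcal{X}_n$ where $W$ ranges over the connected components of $S_\lambda$. For a function $f:\mathbb{R}^d\to\mathbb{R}$ and $\delta>0$, the surrogate clustering $\tilde\psi_{\lambda,\delta}(f)$ is the sub-partition of $\mathcal{X}_n$ given by the graph-theoretic connected components of the graph with vertex set $A_{f,\lambda}=\{x\in\mathcal{X}_n:f(x)\ge\lambda\}$ and edges $\{(x,y):\|x-y\|<\delta\}$. The Inactive/Active Binder loss between sub-partitions $\mathbf{C},\mathbf{C}'$ with active sets $A,A'$, inactive sets $I,I'$ and allocation vectors $c,c'$ is $L(\mathbf{C},\mathbf{C}')=(n-1)m(|A\cap I'|+|I\cap A'|)+\sum_{i<j,\,x_i,x_j\in A\cap A'}a[\mathbf 1(c_i=c_j,c'_i\ne c'_j)+\mathbf 1(c_i\ne c_j,c'_i=c'_j)]$. *)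

(* Defs.v *)
From HB Require Import structures.
From mathcomp Require Import all_boot all_order all_algebra.
From mathcomp Require Import all_classical all_reals all_analysis.
Set Implicit Arguments. Unset Strict Implicit. Unset Printing Implicit Defensive.
Import Order.TTheory GRing.Theory Num.Theory.
Import numFieldNormedType.Exports.
Local Open Scope classical_set_scope.
Local Open Scope ring_scope.

Section Defs.
Variable R : realType.

(* Euclidean norm on R^d, points of R^d being row vectors 'rV[R]_d
   (whose library topology is the product = Euclidean topology). *)
Definition enorm (d : nat) (x : 'rV[R]_d) : R :=
  Num.sqrt (\sum_(i < d) x ord0 i ^+ 2).

Definition row_of_tuple (d : nat) (t : d.-tuple R) : 'rV[R]_d :=
  \row_(i < d) tnth t i.

Fixpoint titer (T : Type) (I : (T -> \bar R) -> \bar R) (n : nat) :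
    (n.-tuple T -> \bar R) -> \bar R :=
  match n with
  | 0 => fun g => g [tuple]
  | n'.+1 => fun g => I (fun x => titer I (fun t : n'.-tuple T => g [tuple of x :: t]))
  end.

(* d-dimensional Lebesgue integral of a nonnegative function on R^d,
   as the iterated one-dimensional Lebesgue integral (Tonelli). *)
Definition leb_int (d : nat) (g : 'rV[R]_d -> \bar R) : \bar R :=
  @titer R (fun h : R -> \bar R => (\int[@lebesgue_measure R]_x h x)%E) d
        (fun t => g (row_of_tuple t)).

Definition unit_ball_vol (d : nat) : R :=
  fine (leb_int (fun x : 'rV[R]_d => (\1_[set y | enorm y <= 1] x)%:E)).

(* Integral w.r.t. the joint law of an i.i.d. sample of size n from the
   density f0 on R^d: the sample (x_1,...,x_n) has joint density
   prod_i f0(x_i) w.r.t. Lebesgue measure on (R^d)^n. *)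
Definition sample_int (d : nat) (f0 : 'rV[R]_d -> R) (n : nat)
    (g : n.-tuple (d.-tuple R) -> \bar R) : \bar R :=
  @titer (d.-tuple R) (fun h : d.-tuple R -> \bar R =>
      @titer R (fun k : R -> \bar R => (\int[@lebesgue_measure R]_x k x)%E) d
        (fun t => ((f0 (row_of_tuple t))%:E * h t)%E)) n g.

Definition level_set (d : nat) (f0 : 'rV[R]_d -> R) (t : R) : set 'rV[R]_d :=
  [set x | t <= f0 x].

(* Inactive/Active Binder loss between two sub-partitions of the indexed
   sample {x_1,...,x_n}, each given by its active predicate and its
   "same cluster" relation (c_i = c_j) on active points. *)
Definition binder_loss (n : nat) (m a : R)
    (act1 act2 : 'I_n -> bool) (same1 same2 : 'I_n -> 'I_n -> bool) : R :=
  (n.-1)%:R * m *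
    (#|[set i | act1 i && ~~ act2 i]| + #|[set i | ~~ act1 i && act2 i]|)%:R
  + \sum_(i < n) \sum_(j < n | [&& (i < j)%N, act1 i, act2 i, act1 j & act2 j])
      a * ((same1 i j && ~~ same2 i j) + (~~ same1 i j && same2 i j))%:R.

Definition psi_act (d n : nat) (f0 : 'rV[R]_d -> R) (lam : R)
    (xs : 'I_n -> 'rV[R]_d) (i : 'I_n) : bool := lam <= f0 (xs i).
Definition psi_same (d n : nat) (f0 : 'rV[R]_d -> R) (lam : R)
    (xs : 'I_n -> 'rV[R]_d) (i j : 'I_n) : bool :=
  `[< connected_component (level_set f0 lam) (xs i) (xs j) >].

Definition surr_edge (d n : nat) (f : 'rV[R]_d -> R) (lam del : R)
    (xs : 'I_n -> 'rV[R]_d) : rel 'I_n :=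
  fun i j => [&& lam <= f (xs i), lam <= f (xs j) & enorm (xs i - xs j) < del].
Definition surr_act (d n : nat) (f : 'rV[R]_d -> R) (lam : R)
    (xs : 'I_n -> 'rV[R]_d) (i : 'I_n) : bool := lam <= f (xs i).
Definition surr_same (d n : nat) (f : 'rV[R]_d -> R) (lam del : R)
    (xs : 'I_n -> 'rV[R]_d) (i j : 'I_n) : bool :=
  connect (surr_edge f lam del xs) i j.

Definition D_loss (d n : nat) (m a : R) (f f0 : 'rV[R]_d -> R) (lam del : R)
    (xs : 'I_n -> 'rV[R]_d) : R :=
  binder_loss m a (surr_act f lam xs) (psi_act f0 lam xs)
    (surr_same f lam del xs) (psi_same f0 lam xs) / ('C(n, 2))%:R.

Definition r_n (d n : nat) (lam : R) : R :=
  2 * powR (16 * d%:R * ln n%:R / (lam * unit_ball_vol d * n%:R)) (d%:R)^-1.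

End Defs.

(* Main.v *)
Require Import Defs.
From HB Require Import structures.
From mathcomp Require Import all_boot all_order all_algebra.
From mathcomp Require Import all_classical all_reals all_analysis.
From mathcomp Require Import measurable_realfun ring lra.
Import Order.TTheory GRing.Theory Num.Theory.
Import numFieldNormedType.Exports.
Local Open Scope classical_set_scope.
Local Open Scope ring_scope.

Set Implicit Arguments. Unset Strict Implicit.

(** Put [eps = gamma + K delta^alpha], with [K] a Hoelder constant.  Two sample
points with [f0 >= lam + eps] are never mismatched.  If a path of the graph joins
them, each edge is a segment on which [f0 >= lam - eps], and hypothesis (iii) lifts
the resulting connection from level [lam - eps] to level [lam + eps].  Conversely,
if they lie in one component of [S_lam], then by (iii) they lie in one component of
the level set at [lam + eps], which is covered by the balls of radius [delta / 2] around the sample points, which are all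
active, and connectedness links the two points in the graph.  Hence the loss is at
most a multiple of the fraction of sample points in the band [|f0 - lam| <= eps].

Two random events are needed.  The first is that every point of [S_lam] is within
[r_n / 2] of the sample: on a net of at most [n^(2d)] points of [S_lam], a slightly
smaller ball has mass at least [4 d ln n / n], hence is missed with probability at
most [n^(-4d)].  The second is a Chernoff bound with base 2 for the number of sample
points in each of [n] bands, whose failure probability is [n^(-2)] per band.  Both
follow from a single Markov inequality, applied to the sum of the indicators of the
missed balls and of the normalised powers of 2.  For small [n] the interval
[[r_n, deltab)] is empty, once [deltab] is chosen small. *)

(* Working with abstract positive functionals avoids building product measures: the last
   field is what makes the class closed under [titer]. *)
Record nonneg_integral (R : realType) d (T : measurableType d)
    (I : (T -> \bar R) -> \bar R) : Prop := NonnegIntegral {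
  nni_ge0 : forall g : T -> \bar R, (forall x, 0 <= g x)%E -> (0 <= I g)%E ;
  nni_le : forall g h : T -> \bar R, measurable_fun setT g -> measurable_fun setT h ->
    (forall x, 0 <= g x)%E -> (forall x, g x <= h x)%E -> (I g <= I h)%E ;
  nni_D : forall g h : T -> \bar R, measurable_fun setT g -> measurable_fun setT h ->
    (forall x, 0 <= g x)%E -> (forall x, 0 <= h x)%E ->
    I (fun x => g x + h x)%E = (I g + I h)%E ;
  nni_Z : forall c (g : T -> \bar R), measurable_fun setT g -> (forall x, 0 <= g x)%E ->
    (0 <= c)%E -> I (fun x => c * g x)%E = (c * I g)%E ;
  nni_measurable : forall d' (U : measurableType d') (g : U * T -> \bar R),
    measurable_fun setT g -> (forall x, 0 <= g x)%E ->
    measurable_fun setT (fun u => I (fun x => g (u, x))) }.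

Section iterated_integral.
Context {R : realType}.

Lemma nonneg_integral_lebesgue :
  nonneg_integral (fun h : R -> \bar R => \int[@lebesgue_measure R]_x h x)%E.
Proof.
split=> [g g0|g h mg mh g0 gh|g h mg mh g0 h0|c g mg g0 c0|d' U g mg g0].
- exact: integral_ge0.
- exact: ge0_le_integral.
- exact: ge0_integralD.
- exact: ge0_integralZl.
- by have := @measurable_fun_fubini_tonelli_F _ _ U _ R (@lebesgue_measure R) g; apply.
Qed.

Lemma nonneg_integral_density d (T : measurableType d)
    (I : (T -> \bar R) -> \bar R) (f : T -> \bar R) :
  measurable_fun setT f -> (forall x, 0 <= f x)%E -> nonneg_integral I ->
  nonneg_integral (fun h => I (fun x => f x * h x)%E).
Proof.
move=> mf f0 [I0 Ile ID IZ Im]; split.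
- by move=> g g0; apply: I0 => x; exact: mule_ge0.
- move=> g h mg mh g0 gh; apply: Ile.
  + exact: emeasurable_funM.
  + exact: emeasurable_funM.
  + by move=> x; exact: mule_ge0.
  + by move=> x; exact: lee_wpmul2l.
- move=> g h mg mh g0 h0; rewrite -ID.
  + by congr I; apply/funext => x; rewrite ge0_muleDr.
  + exact: emeasurable_funM.
  + exact: emeasurable_funM.
  + by move=> x; exact: mule_ge0.
  + by move=> x; exact: mule_ge0.
- move=> c g mg g0 c0; rewrite -IZ//.
  + by congr I; apply/funext => x; rewrite muleCA.
  + exact: emeasurable_funM.
  + by move=> x; exact: mule_ge0.
- move=> d' U g mg g0; apply: (Im _ _ (fun ux => f ux.2 * g ux)%E).
  + apply: emeasurable_funM => //; exact: measurableT_comp.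
  + by move=> x; exact: mule_ge0.
Qed.

Lemma nonneg_integral_titer d (T : measurableType d)
    (I : (T -> \bar R) -> \bar R) n :
  nonneg_integral I -> nonneg_integral (fun g : n.-tuple T -> \bar R => titer I g).
Proof.
move=> [I0 Ile ID IZ Im]; elim: n => [|n [J0 Jle JD JZ Jm]].
  split => //=.
  by move=> d' U g mg g0; apply: (measurableT_comp mg); exact: measurable_pair2.
have mcons (g : n.+1.-tuple T -> \bar R) x : measurable_fun setT g ->
    measurable_fun setT (fun t : n.-tuple T => g [tuple of x :: t]).
  move=> mg; apply: (measurableT_comp mg).
  by apply: measurable_cons => //; exact: measurable_cst.
have mcons2 (g : n.+1.-tuple T -> \bar R) : measurable_fun setT g ->
    measurable_fun setT (fun xt : T * n.-tuple T => g [tuple of xt.1 :: xt.2]).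
  by move=> mg; apply: (measurableT_comp mg); exact: measurable_cons.
have mJ (g : n.+1.-tuple T -> \bar R) : measurable_fun setT g ->
    (forall x, 0 <= g x)%E ->
    measurable_fun setT (fun x => titer I (fun t : n.-tuple T => g [tuple of x :: t])).
  by move=> mg g0; apply: (Jm _ _ (fun xt => g [tuple of xt.1 :: xt.2])) => //; exact: mcons2.
split => /=.
- by move=> g g0; apply: I0 => x; exact: J0.
- move=> g h mg mh g0 gh; have h0 x : (0 <= h x)%E by exact: le_trans (gh x).
  apply: Ile; [exact: mJ|exact: mJ|by move=> x; exact: J0|].
  by move=> x; apply: Jle => //; exact: mcons.
- move=> g h mg mh g0 h0; rewrite -ID.
  + by congr I; apply/funext => x; rewrite JD//; exact: mcons.
  + exact: mJ.
  + exact: mJ.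
  + by move=> x; exact: J0.
  + by move=> x; exact: J0.
- move=> c g mg g0 c0; rewrite -IZ//.
  + by congr I; apply/funext => x; rewrite JZ//; exact: mcons.
  + exact: mJ.
  + by move=> x; exact: J0.
- move=> d' U g mg g0.
  apply: (Im _ _ (fun ux => titer I (fun t : n.-tuple T => g (ux.1, [tuple of ux.2 :: t])))).
  + apply: (Jm _ _ (fun uxt => g (uxt.1.1, [tuple of uxt.1.2 :: uxt.2]))) => //.
    apply: (measurableT_comp mg); apply: measurable_fun_pair => /=.
      exact: measurableT_comp.
    apply: measurable_cons => //; exact: measurableT_comp.
  + by move=> x; exact: J0.
Qed.

Lemma nni_sum d (T : measurableType d) (I : (T -> \bar R) -> \bar R)
    (K : Type) (s : seq K) (g : K -> T -> \bar R) : nonneg_integral I ->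
  (forall k, measurable_fun setT (g k)) -> (forall k x, 0 <= g k x)%E ->
  I (fun x => \sum_(k <- s) g k x)%E = (\sum_(k <- s) I (g k))%E.
Proof.
move=> nI mg g0; elim: s => [|k s IHs].
  rewrite big_nil; under eq_fun do rewrite big_nil.
  transitivity (I (fun=> 0 * 0)%E).
    by rewrite mul0e.
  by rewrite (nni_Z nI (g := fun=> 0%E)) ?mul0e.
rewrite big_cons -IHs -nni_D//.
- by congr I; apply/funext => x; rewrite big_cons.
- by apply: emeasurable_sum.
- by move=> x; exact: sume_ge0.
Qed.

Lemma titer_prod d (T : measurableType d) (I : (T -> \bar R) -> \bar R)
    n (w : T -> R) (p : R) : nonneg_integral I ->
  measurable_fun setT w -> (forall x, 0 <= w x) -> I (EFin \o w) = p%:E ->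
  titer I (fun t : n.-tuple T => (\prod_(i < n) w (tnth t i))%:E) = (p ^+ n)%:E.
Proof.
move=> nI mw w0 Iw.
have mE : measurable_fun setT (EFin \o w) by exact: measurableT_comp.
have E0 x : (0 <= (EFin \o w) x)%E by rewrite lee_fin.
have p0 : 0 <= p by rewrite -lee_fin -Iw; exact: nni_ge0.
elim: n => [|n IHn] /=; first by rewrite big_ord0.
transitivity (I (fun x => (p ^+ n)%:E * (EFin \o w) x)%E); last first.
  by rewrite (nni_Z nI)// ?lee_fin ?exprn_ge0// Iw -EFinM exprSr.
congr I; apply/funext => x.
rewrite muleC -IHn -(nni_Z (nonneg_integral_titer n nI))//.
- congr titer; apply/funext => t; rewrite big_ord_recl tnth0 -EFinM.
  by under eq_bigr do rewrite tnthS.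
- apply/measurable_EFinP; apply: measurable_prod => i _.
  by apply: (measurableT_comp mw); exact: measurable_tnth.
- by move=> t; rewrite lee_fin; exact: prodr_ge0.
Qed.

End iterated_integral.

Section euclidean_norm.
Context {R : realType} {d : nat}.
Implicit Types x y z : 'rV[R]_d.

Lemma sum_sqr_ge0 x : 0 <= \sum_(i < d) x ord0 i ^+ 2.
Proof. by apply: sumr_ge0 => i _; exact: sqr_ge0. Qed.

Lemma enorm_ge0 x : 0 <= enorm x.
Proof. exact: sqrtr_ge0. Qed.

Lemma sqr_enorm x : enorm x ^+ 2 = \sum_(i < d) x ord0 i ^+ 2.
Proof. by rewrite sqr_sqrtr ?sum_sqr_ge0. Qed.

Lemma enormZ (c : R) x : enorm (c *: x) = `|c| * enorm x.
Proof.
rewrite /enorm -sqrtr_sqr -sqrtrM ?sqr_ge0// mulr_sumr.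
by congr Num.sqrt; apply: eq_bigr => i _; rewrite mxE exprMn.
Qed.

Lemma enormN x : enorm (- x) = enorm x.
Proof. by rewrite -scaleN1r enormZ normrN1 mul1r. Qed.

Lemma enormB x y : enorm (x - y) = enorm (y - x).
Proof. by rewrite -enormN opprB. Qed.

Lemma enorm0 : enorm (0 : 'rV[R]_d) = 0.
Proof. by rewrite -(scale0r (0 : 'rV[R]_d)) enormZ normr0 mul0r. Qed.

Lemma cauchy_schwarz_sum x y :
  (\sum_(i < d) x ord0 i * y ord0 i) ^+ 2
  <= (\sum_(i < d) x ord0 i ^+ 2) * (\sum_(i < d) y ord0 i ^+ 2).
Proof.
set S := \sum_i _; set A := \sum_i _; set B := \sum_i _.
rewrite -(ler_pM2l (ltr0Sn R 1)) [leRHS]mulr_natl mulr2n.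
have -> : 2 * S ^+ 2 = \sum_(i < d) \sum_(j < d)
    2 * ((x ord0 i * y ord0 i) * (x ord0 j * y ord0 j)).
  rewrite expr2 mulr_suml mulr_sumr; apply: eq_bigr => i _.
  by rewrite mulr_sumr mulr_sumr; apply: eq_bigr.
have AB : A * B = \sum_(i < d) \sum_(j < d) x ord0 i ^+ 2 * y ord0 j ^+ 2.
  by rewrite mulr_suml; apply: eq_bigr => i _; rewrite mulr_sumr.
rewrite AB [X in _ <= _ + X]exchange_big/= -big_split/=; apply: ler_sum => i _.
rewrite -big_split/=; apply: ler_sum => j _.
have := sqr_ge0 (x ord0 i * y ord0 j - x ord0 j * y ord0 i).
by rewrite -subr_ge0; congr (_ <= _); ring.
Qed.

Lemma enormD x y : enorm (x + y) <= enorm x + enorm y.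
Proof.
have xy0 := addr_ge0 (enorm_ge0 x) (enorm_ge0 y).
rewrite -(@ler_pXn2r _ 2) ?nnegrE ?enorm_ge0// sqrrD !sqr_enorm.
have -> : \sum_(i < d) (x + y) ord0 i ^+ 2 = \sum_(i < d) x ord0 i ^+ 2 +
    (\sum_(i < d) x ord0 i * y ord0 i) *+ 2 + \sum_(i < d) y ord0 i ^+ 2.
  by rewrite -sumrMnl -!big_split/=; apply: eq_bigr => i _; rewrite mxE sqrrD.
rewrite lerD2r lerD2l lerMn2r/=; apply: le_trans (ler_norm _) _.
rewrite -(@ler_pXn2r _ 2) ?nnegrE ?mulr_ge0 ?enorm_ge0//.
by rewrite real_normK ?num_real// exprMn !sqr_enorm cauchy_schwarz_sum.
Qed.

Lemma enorm_triangle y x z : enorm (x - z) <= enorm (x - y) + enorm (y - z).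
Proof. by rewrite -{1}(subrK y x) -addrA; exact: enormD. Qed.

Lemma entry_le_enorm x i : `|x ord0 i| <= enorm x.
Proof.
rewrite -(@ler_pXn2r _ 2) ?nnegrE ?enorm_ge0// sqr_enorm real_normK ?num_real//.
rewrite (bigD1 i)//= lerDl; apply: sumr_ge0 => j _; exact: sqr_ge0.
Qed.

Lemma enorm_le_entries x (c : R) : 0 <= c -> (forall i, `|x ord0 i| <= c) ->
  enorm x <= d%:R * c.
Proof.
move=> c0 xc; rewrite -(@ler_pXn2r _ 2) ?nnegrE ?enorm_ge0 ?mulr_ge0//.
rewrite sqr_enorm exprMn; apply: (@le_trans _ _ (\sum_(i < d) c ^+ 2)).
  apply: ler_sum => i _; rewrite -real_normK ?num_real//.
  by rewrite ler_pXn2r ?nnegrE.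
rewrite sumr_const card_ord -[leLHS]mulr_natl; apply: ler_wpM2r; first exact: sqr_ge0.
by rewrite -natrX ler_nat; case: d => // k; rewrite leq_pmulr.
Qed.

Lemma enorm_continuous : continuous (@enorm R d).
Proof.
have cs : continuous (fun x : 'rV[R]_d => \sum_(i < d) x ord0 i ^+ 2).
  apply: (@continuous_big _ _ +%R 0); first exact: add_continuous.
  move=> i _ x; apply: (@continuous_comp _ _ _ (fun x : 'rV[R]_d => x ord0 i) (fun t => t ^+ 2)).
    exact: coord_continuous.
  exact: exprn_continuous.
by move=> x; apply: (continuous_comp (cs x)); exact: sqrt_continuous.
Qed.

Lemma enorm_sub_continuous z : continuous (fun x => enorm (x - z)).
Proof.
have cB : continuous (fun x : 'rV[R]_d => x - z).
  move=> x; apply: cvgB; [exact: (nbhs_filter x)|exact: cvg_id|].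
  by apply: cvg_cst; exact: (nbhs_filter x).
move=> x; apply: (@continuous_comp _ _ _ (fun x => x - z) (@enorm R d)).
  exact: cB.
exact: enorm_continuous.
Qed.

Lemma open_enorm_ball z r : open [set x | enorm (x - z) < r].
Proof.
apply: (@open_comp _ _ (fun x => enorm (x - z)) [set t | t < r]).
  by move=> x _; exact: enorm_sub_continuous.
exact: open_lt.
Qed.

Lemma segment_component (S : set 'rV[R]_d) x y :
  (forall t : R, 0 <= t <= 1 -> S (x + t *: (y - x))) ->
  connected_component S x y.
Proof.
move=> St; exists [set x + t *: (y - x) | t in `[0, 1]%classic]; last first.
  by exists 1 => /=; rewrite ?in_itv/= ?lexx ?ler01// scale1r addrC subrK.
split.
- by exists 0 => /=; rewrite ?in_itv/= ?lexx ?ler01// scale0r addr0.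
- by move=> z [t /=]; rewrite in_itv/= => t01 <-; exact: St.
- apply: connected_continuous_connected; first exact: segment_connected.
  apply: continuous_subspaceT => t; apply: cvgD; first exact: cvg_cst.
  by have := @cvgZr_tmp R _ _ _ (nbhs_filter t) id t (y - x) cvg_id.
Qed.

End euclidean_norm.

Section clustering.
Context {R : realType} {d n : nat}.
Implicit Types (xs : 'I_n -> 'rV[R]_d).

(* Grouping the balls by whether their centre is reachable from [i] would otherwise
   split [C] into two disjoint relatively open pieces. *)
Lemma connected_cover_connect (e : rel 'I_n) xs (rho : R) (C : set 'rV[R]_d) i j :
  0 < rho -> connected C -> C (xs i) -> C (xs j) ->
  (forall z, C z -> exists k, enorm (z - xs k) < rho) ->
  (forall k l z, C z -> enorm (z - xs k) < rho -> enorm (z - xs l) < rho -> e k l) ->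
  connect e i j.
Proof.
move=> rho0 cC Ci Cj cov edge.
pose O (P : pred 'I_n) := \bigcup_(k in [set k | P k]) [set z | enorm (z - xs k) < rho].
have openO P : open (O P) by apply: bigcup_open => k _; exact: open_enorm_ball.
have self k : enorm (xs k - xs k) < rho by rewrite subrr enorm0.
suff BC : C `&` O (connect e i) = C.
  have : (C `&` O (connect e i)) (xs j) by rewrite BC.
  move=> [_ [k /= ik kj]]; apply: connect_trans ik _; apply: connect1.
  exact: edge kj (self j).
apply: cC; first by exists (xs i); split => //; exists i => //=; exact: connect0.
- by exists (O (connect e i)).
- exists (~` O (predC (connect e i))); first exact: open_closedC.
  apply/seteqP; split => z [Cz Oz]; split => //.
    move=> [l /= il zl]; case: Oz => k /= ik zk; move/negP: il; apply.
    by apply: connect_trans ik _; apply: connect1; exact: edge zk zl.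
  have [k zk] := cov z Cz; exists k => //=.
  by apply: contrapT => /negP ik; apply: Oz; exists k.
Qed.

Lemma connected_component_subset (S T : set 'rV[R]_d) x y :
  S `<=` T -> connected_component S x y -> connected_component T x y.
Proof.
move=> ST [C [Cx CS cC] Cy]; exists C => //; split => //.
exact: subset_trans ST.
Qed.

Section mismatch.
Context {f f0 : 'rV[R]_d -> R} {xs : 'I_n -> 'rV[R]_d}.
Context {lam alpha K del gam : R}.
Hypotheses (alpha0 : 0 < alpha) (K0 : 0 < K) (del0 : 0 < del) (gam0 : 0 < gam).
Hypothesis holder : forall x y, `|f0 x - f0 y| <= K * powR (enorm (x - y)) alpha.
Hypothesis ffam : forall x, `|f x - f0 x| <= gam.
Let eps := gam + K * powR del alpha.
Hypothesis persistent : forall x y,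
  level_set f0 (lam + eps) x -> level_set f0 (lam + eps) y ->
  connected_component (level_set f0 (lam - eps)) x y ->
  connected_component (level_set f0 (lam + eps)) x y.
Hypothesis cover : forall z, lam <= f0 z -> exists k, enorm (z - xs k) < del / 2.

Let eps0 : 0 < eps.
Proof. by rewrite addr_gt0// mulr_gt0// powR_gt0. Qed.

Let holder_le x y (t : R) : enorm (x - y) <= t -> f0 x - f0 y <= K * powR t alpha.
Proof.
move=> xyt; apply: le_trans (ler_norm _) _; apply: le_trans (holder _ _) _.
rewrite ler_pM2l//; apply: ge0_ler_powR => //; first exact: ltW.
  by rewrite nnegrE enorm_ge0.
by rewrite nnegrE (le_trans (enorm_ge0 _) xyt).
Qed.

Let connect_component i j :
  lam <= f0 (xs i) -> connect (surr_edge f lam del xs) i j ->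
  connected_component (level_set f0 (lam - eps)) (xs i) (xs j).
Proof.
have edge k l : surr_edge f lam del xs k l ->
    connected_component (level_set f0 (lam - eps)) (xs k) (xs l).
  case/and3P => fk _ kl; apply: segment_component => t /andP[t0 t1].
  rewrite /level_set/=.
  have := ffam (xs k); rewrite ler_norml => /andP[_ fk'].
  have : f0 (xs k) - f0 (xs k + t *: (xs l - xs k)) <= K * powR del alpha.
    apply: holder_le; rewrite opprD addrA subrr sub0r enormN enormZ ger0_norm//.
    rewrite enormB; apply: le_trans (ltW kl); rewrite ler_piMl ?enorm_ge0//.
  by rewrite /eps; lra.
move=> fi /connectP[p]; elim/last_ind: p j => [|p k IHp] j /=.
  move=> _ ->; apply: connected_component_refl; rewrite /level_set/=.
  by have := eps0; lra.
rewrite rcons_path last_rcons => /andP[ip pk] ->.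
exact: connected_component_trans (IHp _ ip erefl) (edge _ _ pk).
Qed.

Lemma same_off_band i j : lam + eps <= f0 (xs i) -> lam + eps <= f0 (xs j) ->
  surr_same f lam del xs i j = psi_same f0 lam xs i j.
Proof.
move=> fi fj; have e0 := eps0; apply/idP/asboolP => [ij|ij].
  apply: (connected_component_subset (S := level_set f0 (lam + eps))).
    by move=> z; rewrite /level_set/=; lra.
  by apply: persistent => //; apply: connect_component => //; lra.
have [C [Ci CS cC] Cj] : connected_component (level_set f0 (lam + eps)) (xs i) (xs j).
  apply: persistent => //; apply: connected_component_subset ij => z.
  by rewrite /level_set/=; lra.
apply: (connected_cover_connect (xs := xs) (rho := del / 2) (C := C)) => //.
- by rewrite divr_gt0.
- by move=> z /CS; rewrite /level_set/= => fz; apply: cover; lra.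
- have act k z : C z -> enorm (z - xs k) < del / 2 -> lam <= f (xs k).
    move=> /CS; rewrite /level_set/= => fz zk.
    have : f0 z - f0 (xs k) <= K * powR del alpha.
      by apply: holder_le; have d0 := del0; lra.
    have := ffam (xs k); rewrite ler_norml => /andP[fk _].
    by move: fz; rewrite /eps; lra.
  move=> k l z Cz zk zl; apply/and3P; split; [exact: act zk|exact: act zl|].
  by have := enorm_triangle z (xs k) (xs l); rewrite (enormB (xs k) z); lra.
Qed.

Let band : pred 'I_n := fun i => `|f0 (xs i) - lam| <= eps.

Let off_band i : lam <= f0 (xs i) -> ~~ band i -> lam + eps <= f0 (xs i).
Proof.
by move=> fi; rewrite /band -ltNge ger0_norm ?subr_ge0//; lra.
Qed.

Lemma D_loss_le_band (a m : R) : (2 <= n)%N -> 0 < a <= 1 -> 0 < m <= 1 ->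
  D_loss m a f f0 lam del xs <= 16 * #|band|%:R / n%:R.
Proof.
move=> n2 /andP[a0 a1] /andP[m0 m1].
have gameps : gam <= eps by rewrite lerDl mulr_ge0 ?powR_ge0// ltW.
have bandP i : surr_act f lam xs i != psi_act f0 lam xs i -> band i.
  move=> neq; have := ffam (xs i); rewrite /band !ler_norml => /andP[h1 h2].
  move: neq; rewrite /surr_act /psi_act.
  have [h3|h3] := leP lam (f (xs i)); have [h4|h4] := leP lam (f0 (xs i)) => // _.
    by apply/andP; split; lra.
  by apply/andP; split; lra.
have count1 : (#|[set i | surr_act f lam xs i && ~~ psi_act f0 lam xs i]| <= #|band|)%N.
  apply/subset_leq_card/fintype.subsetP => i; rewrite inE/= => /andP[fi f0i].
  by rewrite unfold_in; apply: bandP; rewrite fi (negbTE f0i).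
have count2 : (#|[set i | ~~ surr_act f lam xs i && psi_act f0 lam xs i]| <= #|band|)%N.
  apply/subset_leq_card/fintype.subsetP => i; rewrite inE/= => /andP[fi f0i].
  by rewrite unfold_in; apply: bandP; rewrite f0i (negbTE fi).
have sumb : \sum_(i < n) (band i)%:R = #|band|%:R :> R.
  by rewrite -natr_sum -sum1_card [in RHS]big_mkcond/=; congr (_%:R).
have n0 : 0 < n%:R :> R by rewrite ltr0n (leq_trans _ n2).
have n1E : n%:R = n.-1%:R + 1 :> R by rewrite natr1 prednK// (leq_trans _ n2).
have n11 : 1 <= n.-1%:R :> R by rewrite ler1n -ltnS prednK// (leq_trans _ n2).
have bin2E : 'C(n, 2)%:R = n%:R * n.-1%:R / 2 :> R.
  have /(congr1 (fun k => k%:R : R)) := bin_ffact n 2.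
  by rewrite !ffactnS ffactn0 muln1 natrM natrM => <-; rewrite mulfK.
rewrite /D_loss ler_pdivrMr; last by rewrite bin2E !mulr_gt0 ?invr_gt0//; lra.
rewrite /binder_loss.
have pairs : \sum_(i < n) \sum_(j < n | [&& (i < j)%N, surr_act f lam xs i,
      psi_act f0 lam xs i, surr_act f lam xs j & psi_act f0 lam xs j])
      a * ((surr_same f lam del xs i j && ~~ psi_same f0 lam xs i j)
        + (~~ surr_same f lam del xs i j && psi_same f0 lam xs i j))%:R
    <= 2 * n%:R * #|band|%:R.
  apply: (@le_trans _ _ (\sum_(i < n) \sum_(j < n) ((band i)%:R + (band j)%:R))).
    apply: ler_sum => i _; rewrite big_mkcond/=; apply: ler_sum => j _.
    case: ifPn => [/and5P[_ _ fi _ fj]|_]; last by rewrite addr_ge0.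
    have [bij|] := boolP (band i || band j).
      apply: (@le_trans _ _ 1).
        rewrite -[leRHS]mulr1; apply: ler_pM; rewrite ?ler0n//; first exact: ltW.
        by case: surr_same; case: psi_same; rewrite /= ?addn0 ?add0n ?ler_nat.
      by move: bij; case: (band i); case: (band j) => //= _; lra.
    rewrite negb_or => /andP[bi bj].
    rewrite same_off_band ?off_band// andbN andNb mulr0 addr_ge0//.
  under eq_bigr do rewrite big_split/= sumr_const card_ord sumb.
  by rewrite big_split/= sumr_const card_ord sumrMnl sumb -mulr_natl; lra.
apply: (@le_trans _ _ (n.-1%:R * 1 * (#|band|%:R + #|band|%:R) + 2 * n%:R * #|band|%:R)).
  apply: lerD pairs; rewrite natrD; apply: ler_pM; rewrite ?mulr_ge0//; [exact: ltW| |].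
    by rewrite ler_wpM2l.
  by rewrite lerD// ler_nat.
rewrite bin2E mulrA -[X in _ <= X / 2]mulrA (mulrC n%:R) -!mulrA.
set N := #|band|%:R; have N0 : 0 <= N by rewrite ler0n.
have -> : 16 * (N * (n%:R^-1 * (n.-1%:R * (n%:R * 2^-1)))) = 8 * N * n.-1%:R :> R.
  by field; rewrite gt_eqF.
by rewrite n1E; nra.
Qed.
End mismatch.
End clustering.

Section lebesgue_affine.
Context {R : realType}.
Local Notation mu := (@lebesgue_measure R).

Lemma measurable_affine (a c : R) : measurable_fun setT (fun x : R => a + c * x).
Proof.
apply: continuous_measurable_fun => x; apply: cvgD; first exact: cvg_cst.
by apply: cvgM; [exact: cvg_cst|exact: cvg_id].
Qed.

Lemma lebesgue_measure_affine (a c : R) (A : set R) : 0 < c -> measurable A ->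
  mu A = (c%:E * mu ((fun x => (a + c * x)%R) @^-1` A))%E.
Proof.
move=> c0 mA.
pose phi : measurableTypeR R -> measurableTypeR R := fun x => a + c * x.
have mphi : measurable_fun setT phi by exact: measurable_affine.
(* Named explicitly because inference leaves the measurability of [phi] unresolved. *)
pose nu := measure_function_pushforward__canonical__measure_function_Measure mu mphi.
rewrite -[RHS]/(mscale (NngNum (ltW c0)) nu A).
apply: lebesgue_measure_unique => // _ [[u v]] _ <-.
change (mu `]u, v]%classic = (c%:E * mu (phi @^-1` `]u, v]%classic))%E).
have -> : phi @^-1` `]u, v]%classic = `](u - a) / c, (v - a) / c]%classic.
  apply/seteqP; split => x /=; rewrite !in_itv/= /phi ltr_pdivrMr// ler_pdivlMr//;
    by rewrite mulrC; lra.
rewrite !lebesgue_measure_itv/= !lte_fin ltr_pM2r ?invr_gt0// ltrD2r.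
case: ifP => uv; last by rewrite mule0.
by rewrite -!EFinB -EFinM; congr EFin; field; rewrite gt_eqF.
Qed.

Lemma integral_affine (a c : R) (g : R -> \bar R) : 0 < c ->
  measurable_fun setT g -> (forall x, 0 <= g x)%E ->
  (\int[mu]_x g x = c%:E * \int[mu]_x g (a + c * x)%R)%E.
Proof.
move=> c0 mg g0.
pose phi : measurableTypeR R -> measurableTypeR R := fun x => a + c * x.
have mphi : measurable_fun setT phi by exact: measurable_affine.
have := @ge0_integral_pushforward _ _ _ _ R phi mphi mu setT g measurableT mg (fun x _ => g0 x).
rewrite preimage_setT => <-.
rewrite -(ge0_integral_mscale _ measurableT (NngNum (ltW c0)))//.
by apply: eq_measure_integral => A mA _; exact: lebesgue_measure_affine.
Qed.

Lemma leb_int_affine d (z : d.-tuple R) (c : R) (g : d.-tuple R -> \bar R) : 0 < c ->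
  measurable_fun setT g -> (forall x, 0 <= g x)%E ->
  (titer (fun h : R -> \bar R => \int[mu]_x h x) g =
   (c ^+ d)%:E * titer (fun h : R -> \bar R => \int[mu]_x h x)
     (fun t => g [tuple (tnth z i + c * tnth t i)%R | i < d]))%E.
Proof.
move=> c0; elim: d z g => [|d IHd] z g mg g0 /=.
  by rewrite expr0 mul1e; congr g; apply: eq_from_tnth => -[].
have mcons x : measurable_fun setT (fun t : d.-tuple R => g [tuple of x :: t]).
  apply: (measurableT_comp mg).
  by apply: measurable_cons => //; exact: measurable_cst.
have nI := nonneg_integral_titer d (@nonneg_integral_lebesgue R).
have mtiter (h : d.+1.-tuple R -> \bar R) : measurable_fun setT h -> (forall x, 0 <= h x)%E ->
    measurable_fun setT (fun x : R =>
      titer (fun h : R -> \bar R => \int[mu]_x h x)%E (fun t : d.-tuple R => h [tuple of x :: t])).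
  move=> mh h0; apply: (nni_measurable nI (g := fun xt => h [tuple of xt.1 :: xt.2])) => //.
  by apply: (measurableT_comp mh); exact: measurable_cons.
rewrite (integral_affine (tnth z ord0) c0); first last.
- by move=> x; exact: nni_ge0.
- exact: mtiter.
rewrite exprS EFinM -muleA; congr mule.
pose aff (t : d.+1.-tuple R) := [tuple (tnth z i + c * tnth t i)%R | i < d.+1].
have maff : measurable_fun setT aff.
  apply/measurable_fun_tnthP => i.
  rewrite (_ : _ \o _ = (fun x => tnth z i + c * x) \o (fun t => tnth t i)); last first.
    by apply/funext => t; rewrite /= tnth_mktuple.
  by apply: measurableT_comp; [exact: measurable_affine|exact: measurable_tnth].
rewrite -ge0_integralZl_EFin ?exprn_ge0 ?ltW//.
- apply: eq_integral => x _; rewrite (IHd [tuple of behead z])//.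
  congr (_ * titer _ _)%E; apply/funext => t; congr g; apply: eq_from_tnth => i.
  rewrite tnth_mktuple; case: (unliftP ord0 i) => [j|] ->; last by rewrite !tnth0.
  rewrite !tnthS tnth_mktuple tnth_behead; congr (tnth z _ + _).
  by apply: val_inj; rewrite /= inordK// ltnS.
- by move=> x _; exact: nni_ge0.
- by apply: (mtiter (g \o aff)); [exact: (measurableT_comp mg maff)|move=> t; exact: g0].
Qed.
End lebesgue_affine.

Section row_measurable.
Context {R : realType} {d : nat}.

Lemma open_row_measurable (U : set 'rV[R]_d) : open U ->
  measurable (@row_of_tuple R d @^-1` U).
Proof.
move=> oU.
pose box (qk : d.-tuple rat * nat) : set (d.-tuple R) :=
  \bigcap_(i in [set: 'I_d]) (fun t : d.-tuple R => tnth t i) @^-1`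
     [set x | `|x - ratr (tnth qk.1 i)| < qk.2.+1%:R^-1].
have mbox qk : measurable (box qk).
  apply: fin_bigcap_measurable => // i _.
  rewrite -[X in measurable X]setTI; apply: measurable_tnth => //.
  apply: open_measurable.
  have -> : [set x | `|x - ratr (tnth qk.1 i)| < qk.2.+1%:R^-1]
     = ball (ratr (tnth qk.1 i) : R) qk.2.+1%:R^-1.
    by apply/seteqP; split => x /=; rewrite -ball_normE/= distrC.
  exact: ball_open.
have -> : @row_of_tuple R d @^-1` U =
    \bigcup_(qk in [set qk | box qk `<=` @row_of_tuple R d @^-1` U]) box qk.
  apply/seteqP; split => [t Ut|t [qk /= sub]]; last exact: sub.
  have /nbhs_ballP[e /= e0 eU] : nbhs (row_of_tuple t) U by exact: open_nbhs_nbhs.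
  have [k ke] : exists k : nat, k.+1%:R^-1 < e / 2.
    exists (Num.truncn (e / 2)^-1); rewrite invf_plt ?posrE ?divr_gt0//.
    by rewrite truncnS_gt.
  set u := k.+1%:R^-1 in ke.
  have u0 : 0 < u by rewrite invr_gt0.
  have /choice[q Hq] i : exists q : rat, `|tnth t i - ratr q| < u.
    have [|q] := @rat_in_itvoo R (tnth t i - u) (tnth t i).
      by rewrite ltrBlDr ltrDl.
    rewrite in_itv/= => /andP[q1 q2]; exists q.
    by rewrite gtr0_norm; lra.
  exists ([tuple q i | i < d], k); last first.
    by move=> i _ /=; rewrite tnth_mktuple.
  move=> t' /= t'box; apply: eU => /=; split=> // i j; rewrite !mxE.
  have := t'box j I; rewrite /= tnth_mktuple -/u => h.
  rewrite /ball/= -(subrK (ratr (q j)) (tnth t j)) -addrA.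
  apply: le_lt_trans (ler_normD _ _) _.
  by rewrite [X in _ + X]distrC; have := Hq j; lra.
rewrite bigcup_mkcond; apply: countable_bigcupT_measurable; first exact: countableP.
by move=> qk; case: ifP => // _; exact: mbox.
Qed.

Lemma measurable_continuous_row (g : 'rV[R]_d -> R) : continuous g ->
  measurable_fun setT (g \o @row_of_tuple R d).
Proof.
move=> cg; apply: (measurability _ (RGenOpens.measurableE R)).
move=> _ [_ [a [b ->] <-]]; rewrite setTI comp_preimage; apply: open_row_measurable.
by apply: (@open_comp _ _ g) => [x _|]; [exact: cg|exact: interval_open].
Qed.

End row_measurable.

Section sampling.
Context {R : realType} {d : measure_display} {T : measurableType d}.
Variable (I : (T -> \bar R) -> \bar R).
Hypothesis nI : nonneg_integral I.

Lemma titer_prod_le n (w : T -> R) (p : R) :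
  measurable_fun setT w -> (forall x, 0 <= w x) -> (I (EFin \o w) <= p%:E)%E ->
  (titer I (fun t : n.-tuple T => (\prod_(i < n) w (tnth t i))%:E) <= (p ^+ n)%:E)%E.
Proof.
move=> mw w0 Iwp.
have I0 : (0 <= I (EFin \o w))%E by apply: nni_ge0 => // x; rewrite lee_fin.
have fI : I (EFin \o w) \is a fin_num.
  by rewrite ge0_fin_numE// (le_lt_trans Iwp)// ltry.
rewrite (titer_prod n nI mw w0 (p := fine (I (EFin \o w)))); last by rewrite fineK.
rewrite lee_fin lerXn2r ?nnegrE ?fine_ge0//; last by rewrite -lee_fin fineK.
by rewrite -lee_fin (le_trans I0).
Qed.

Lemma titer1 n : I (fun=> 1%:E) = 1%:E -> @titer R T I n (fun=> 1%:E) = 1%:E.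
Proof.
move=> I1.
transitivity (titer I (fun s : n.-tuple T => (\prod_(i < n) cst (1 : R) (tnth s i))%:E)).
  by congr titer; apply/funext => s; rewrite big1.
by rewrite (titer_prod (p := 1) n nI) ?expr1n.
Qed.

Lemma markov_good_set (H : T -> R) (c : R) : measurable_fun setT H ->
  (forall x, 0 <= H x) -> I (fun=> 1%:E) = 1%:E -> (I (EFin \o H) <= c%:E)%E ->
  measurable [set x | H x < 1] /\
  ((1 - c)%:E <= I (fun x => (\1_[set x | H x < 1] x)%:E))%E.
Proof.
move=> mH H0 I1 IH.
have mG : measurable [set x | H x < 1].
  by rewrite -[X in measurable X]setTI; exact: measurable_fun_ltr.
split=> //.
have mE : measurable_fun setT (EFin \o H) by exact: measurableT_comp.
have mind : measurable_fun setT (fun x => (\1_[set x | H x < 1] x : R)%:E).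
  by apply/measurable_EFinP; exact: measurable_indic.
have : (1%:E <= I (fun x => (\1_[set x | H x < 1] x)%:E) + c%:E)%E.
  apply: le_trans (leeD2l _ IH).
  rewrite -(nni_D nI mind mE); [|by move=> x; rewrite lee_fin..].
  rewrite -I1; apply: (nni_le nI) => //.
    by apply: emeasurable_funD.
  move=> x; rewrite -EFinD lee_fin indicE; case: (ltP (H x) 1) => Hx.
    by rewrite mem_set// lerDl.
  by rewrite memNset ?add0r//= ; apply/negP; rewrite -leNgt.
by rewrite EFinB leeBlDr.
Qed.

End sampling.

Section sampling_event.
Context {R : realType} {d : measure_display} {T : measurableType d}.
Variable (I : (T -> \bar R) -> \bar R).
Hypothesis nI : nonneg_integral I.

Lemma sampling_event n (K : finType) (B : K -> set T) (m : nat) (A : 'I_m -> set T)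
    (q : R) (p : 'I_m -> R) : (0 < n)%N -> I (fun=> 1%:E) = 1%:E ->
  (forall k, measurable (B k)) -> (forall l, measurable (A l)) ->
  (forall k, (I (fun x => (\1_(~` B k) x)%:E) <= q%:E)%E) ->
  (forall l, 0 <= p l) -> (forall l, (I (fun x => (\1_(A l) x)%:E) <= (p l)%:E)%E) ->
  exists G : set (n.-tuple T), measurable G /\
    ((1 - (#|K|%:R * q ^+ n + m%:R / n%:R ^+ 2))%:E
      <= titer I (fun s => (\1_G s)%:E))%E /\
    forall s, G s -> (forall k, exists i, B k (tnth s i)) /\
      (forall l, (2 : R) ^+ #|[pred i | tnth s i \in A l]| < n%:R ^+ 2 * (1 + p l) ^+ n).
Proof.
move=> n0 I1 mB mA IB p0 IA.
pose w k x : R := \1_(~` B k) x.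
pose v l x : R := 1 + \1_(A l) x.
have mw k : measurable_fun setT (w k).
  by apply: measurable_indic; exact: measurableC.
have mv l : measurable_fun setT (v l).
  by apply: measurable_funD => //; exact: measurable_indic.
have w0 k x : 0 <= w k x by rewrite /w.
have v0 l x : 0 <= v l x by rewrite /v addr_ge0.
pose N l : R := n%:R ^+ 2 * (1 + p l) ^+ n.
have N0 l : 0 < N l by rewrite mulr_gt0// exprn_gt0 ?ltr0n// ltr_wpDr.
pose W k (s : n.-tuple T) : R := \prod_(i < n) w k (tnth s i).
pose V l (s : n.-tuple T) : R := (N l)^-1 * \prod_(i < n) v l (tnth s i).
have mpr (u : T -> R) : measurable_fun setT u ->
    measurable_fun setT (fun s : n.-tuple T => \prod_(i < n) u (tnth s i)).
  move=> mu; apply: measurable_prod => i _.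
  by apply: (measurableT_comp mu); exact: measurable_tnth.
have mW k : measurable_fun setT (W k) by exact: mpr.
have mV l : measurable_fun setT (V l).
  by apply: measurable_funM => //; exact: mpr.
have W0 k s : 0 <= W k s by apply: prodr_ge0.
have V0 l s : 0 <= V l s.
  by apply: mulr_ge0; [rewrite invr_ge0 ltW|apply: prodr_ge0].
have nJ := nonneg_integral_titer n nI.
have J1 := titer1 nI n I1.
have IW k : (titer I (EFin \o W k) <= (q ^+ n)%:E)%E.
  exact: (titer_prod_le nI n (mw k) (w0 k) (IB k)).
have IV l : (titer I (EFin \o V l) <= (n%:R ^- 2)%:E)%E.
  rewrite [X in titer I X](_ : _ = fun s => ((N l)^-1%:E *
      (\prod_(i < n) v l (tnth s i))%:E)%E); last by apply/funext => s; rewrite -EFinM.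
  rewrite (nni_Z nJ); first last.
  - by rewrite lee_fin invr_ge0 ltW.
  - by move=> s; rewrite lee_fin; apply: prodr_ge0.
  - by apply/measurable_EFinP; exact: mpr.
  apply: (@le_trans _ _ ((N l)^-1%:E * ((1 + p l) ^+ n)%:E)%E).
    apply: lee_wpmul2l; first by rewrite lee_fin invr_ge0 ltW.
    apply: titer_prod_le => //.
    rewrite [X in I X](_ : _ = fun x => (1%:E + (\1_(A l) x)%:E)%E)//.
    rewrite (nni_D nI); first last.
    - by move=> x; rewrite lee_fin.
    - by move=> x; rewrite lee_fin.
    - by apply/measurable_EFinP; exact: measurable_indic.
    - exact: measurable_cst.
    by rewrite I1 EFinD leeD2l.
  rewrite -EFinM lee_fin /N invfM mulrAC -mulrA divff ?mulr1//.
  by rewrite expf_neq0// gt_eqF// ltr_wpDr.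
pose H s := \sum_k W k s + \sum_l V l s.
have mH : measurable_fun setT H by apply: measurable_funD; exact: measurable_sum.
have H0 s : 0 <= H s by rewrite addr_ge0// sumr_ge0.
have IH : (titer I (EFin \o H) <= (#|K|%:R * q ^+ n + m%:R / n%:R ^+ 2)%:E)%E.
  rewrite [X in titer I X](_ : _ = fun s => (\sum_k (EFin \o W k) s +
      \sum_l (EFin \o V l) s)%E); last first.
    by apply/funext => s; rewrite /H /= EFinD !sumEFin.
  rewrite (nni_D nJ); first last.
  - by move=> s; apply: sume_ge0 => l _; rewrite lee_fin.
  - by move=> s; apply: sume_ge0 => l _; rewrite lee_fin.
  - by apply: emeasurable_sum => l; exact/measurable_EFinP.
  - by apply: emeasurable_sum => l; exact/measurable_EFinP.
  rewrite !(nni_sum _ nJ) => [|k|k s|k|k s]; last 4 first.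
  - exact/measurable_EFinP.
  - by rewrite lee_fin.
  - exact/measurable_EFinP.
  - by rewrite lee_fin.
  rewrite EFinD; apply: leeD.
    apply: le_trans (lee_sum _ (fun k _ => IW k)) _.
    by rewrite sumEFin sumr_const mulr_natl.
  apply: le_trans (lee_sum _ (fun l _ => IV l)) _.
  by rewrite sumEFin sumr_const card_ord mulr_natl.
have [mG IG] := markov_good_set nJ mH H0 J1 IH.
exists [set s | H s < 1]; split => //; split => // s /= Hs.
have sW0 : 0 <= \sum_k W k s by exact: sumr_ge0.
have sV0 : 0 <= \sum_l V l s by exact: sumr_ge0.
split=> [k|l].
  apply: contrapT => /forallNP noB.
  have : W k s = 1.
    by apply: big1 => i _; rewrite /w indicE mem_set//; exact: noB.
  have : W k s <= \sum_k W k s by rewrite (bigD1 k)//= lerDl sumr_ge0.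
  by move: Hs; rewrite /H; lra.
have : V l s <= \sum_l V l s by rewrite (bigD1 l)//= lerDl sumr_ge0.
have -> : V l s = (N l)^-1 * 2 ^+ #|[pred i | tnth s i \in A l]|.
  congr (_ * _); rewrite -prodr_const [RHS]big_mkcond/=; apply: eq_bigr => i _.
  by rewrite /v indicE inE; case: (tnth s i \in A l); rewrite ?addr0.
move=> Vle; have : (N l)^-1 * 2 ^+ #|[pred i | tnth s i \in A l]| < 1.
  by move: Hs; rewrite /H; lra.
by rewrite mulrC ltr_pdivrMr// mul1r.
Qed.
End sampling_event.

Section ball_volume.
Context {R : realType} {d : nat}.
Local Notation leb := (@titer R R (fun h : R -> \bar R => (\int[@lebesgue_measure R]_x h x)%E) d).

Let nleb : nonneg_integral leb.
Proof. exact: nonneg_integral_titer (@nonneg_integral_lebesgue R). Qed.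

Definition row_ball (z : 'rV[R]_d) (r : R) : set (d.-tuple R) :=
  [set t | enorm (row_of_tuple t - z) <= r].

Lemma measurable_row_ball z r : measurable (row_ball z r).
Proof.
rewrite -[X in measurable X]setTI.
apply: (measurable_fun_ler (f := fun t : d.-tuple R => enorm (row_of_tuple t - z))
  (g := fun=> r)) => //.
exact: (measurable_continuous_row (@enorm_sub_continuous R d z)).
Qed.

Lemma measurable_indic_EFin (A : set (d.-tuple R)) : measurable A ->
  measurable_fun setT (fun t => (\1_A t : R)%:E).
Proof. by move=> mA; apply/measurable_EFinP; exact: measurable_indic. Qed.

Lemma leb_row_ball z (r : R) : 0 < r ->
  leb (fun t => (\1_(row_ball z r) t)%:E) =
  ((r ^+ d)%:E * leb (fun t => (\1_(row_ball 0 1) t)%:E))%E.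
Proof.
move=> r0; rewrite (leb_int_affine [tuple z ord0 i | i < d] r0); first last.
- by move=> t; rewrite lee_fin.
- exact: (measurable_indic_EFin (measurable_row_ball z r)).
congr (_ * leb _)%E; apply/funext => t; congr (_%:E); rewrite !indicE.
congr (_%:R); congr nat_of_bool; apply: asbool_equiv_eq; rewrite /row_ball/= subr0.
have -> : row_of_tuple [tuple tnth [tuple z ord0 i | i < d] i + r * tnth t i | i < d] - z
    = r *: row_of_tuple t.
  by apply/rowP => i; rewrite !mxE !tnth_mktuple addrC addKr.
by rewrite enormZ gtr0_norm// -ler_pdivlMl// mulrC divff ?gt_eqF.
Qed.

Let cube_indic (c : R) (t : d.-tuple R) :
  (\prod_(i < d) (\1_(`[- c, c]%classic : set R) (tnth t i) : R))%:E
    = (\1_[set t : d.-tuple R | forall i, `|tnth t i| <= c] t)%:E :> \bar R.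
Proof.
congr EFin; rewrite indicE; have [/= tc|] := boolP (t \in _).
  rewrite big1// => i _; rewrite indicE mem_set//=.
  by rewrite in_itv/= -ler_norml; move: tc; rewrite inE.
rewrite notin_setE/= => /existsNP[i /negP tc].
by rewrite (bigD1 i)//= indicE memNset ?mul0r//= in_itv/= -ler_norml; exact/negP.
Qed.

Let leb_cube (c : R) : 0 < c ->
  leb (fun t => (\1_[set t : d.-tuple R | forall i, `|tnth t i| <= c] t)%:E)
  = ((c *+ 2) ^+ d)%:E.
Proof.
move=> c0.
have mi : measurable_fun setT (\1_(`[- c, c]%classic) : R -> R).
  by apply: measurable_indic; exact: measurable_itv.
have Ii : (\int[@lebesgue_measure R]_x ((\1_(`[- c, c]%classic) : R -> R) x)%:E = (c *+ 2)%:E)%E.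
  rewrite integral_indic// setIT -[LHS]/(@lebesgue_measure R _) lebesgue_measure_itv/= lte_fin ifT; last by lra.
  by rewrite -EFinB; congr EFin; lra.
rewrite -(titer_prod d (@nonneg_integral_lebesgue R) mi _ Ii)//.
by congr (leb _); apply/funext => t; rewrite cube_indic.
Qed.

Lemma unit_ball_vol_gt0 : (0 < d)%N -> 0 < unit_ball_vol R d /\
  leb (fun t => (\1_(row_ball 0 1) t)%:E) = (unit_ball_vol R d)%:E.
Proof.
move=> d0; have dR : 0 < d%:R :> R by rewrite ltr0n.
have volE : unit_ball_vol R d = fine (leb (fun t => (\1_(row_ball 0 1) t)%:E)).
  congr (fine (leb _)); apply/funext => t; congr EFin; rewrite !indicE.
  congr (_%:R); congr nat_of_bool; apply: asbool_equiv_eq.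
  by rewrite /row_ball/= subr0.
have mcube (c : R) : measurable_fun setT
    (fun t => (\1_[set t : d.-tuple R | forall i, `|tnth t i| <= c] t : R)%:E).
  under eq_fun do rewrite -cube_indic.
  apply/measurable_EFinP; apply: measurable_prod => i _.
  apply: (measurableT_comp _ (measurable_tnth i)); apply: measurable_indic.
  exact: measurable_itv.
have mball := measurable_indic_EFin (measurable_row_ball 0 1).
have indic_le (A B : set (d.-tuple R)) t : A `<=` B -> ((\1_A t : R)%:E <= (\1_B t)%:E)%E.
  move=> AB; rewrite lee_fin !indicE ler_nat.
  by have [/set_mem/AB/mem_set->|] := boolP (t \in A).
have up : (leb (fun t => (\1_(row_ball 0 1) t)%:E) <= ((1 *+ 2) ^+ d)%:E)%E.
  rewrite -leb_cube//; apply: (nni_le nleb) => // t.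
  apply: indic_le => u; rewrite /row_ball/= subr0 => h i.
  by have := entry_le_enorm (row_of_tuple u) i; rewrite mxE => /le_trans; exact.
have low : (((d%:R^-1 *+ 2) ^+ d)%:E <= leb (fun t => (\1_(row_ball 0 1) t)%:E))%E.
  rewrite -leb_cube ?invr_gt0//; apply: (nni_le nleb) => // t.
  apply: indic_le => u h; rewrite /row_ball/= subr0.
  have := @enorm_le_entries R d (row_of_tuple u) d%:R^-1; rewrite divff ?gt_eqF//.
  by apply; [rewrite invr_ge0 ltW|move=> i; rewrite mxE].
have fin : leb (fun t => (\1_(row_ball 0 1) t)%:E) \is a fin_num.
  rewrite ge0_fin_numE; first by rewrite (le_lt_trans up)// ltry.
  by apply: (nni_ge0 nleb) => t; rewrite lee_fin.
rewrite volE; split; last by rewrite fineK.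
rewrite -lte_fin fineK//; apply: lt_le_trans low.
by rewrite lte_fin exprn_gt0// pmulrn_lgt0// invr_gt0.
Qed.

End ball_volume.

Lemma finite_net (R : realType) d (S : set 'rV[R]_d) (M w : R) (N : nat) :
  0 < w -> (forall z, S z -> enorm z <= M) -> M *+ 2 < N%:R * w ->
  exists (K : finType) (rep : K -> 'rV[R]_d),
    [/\ (#|K| <= N ^ d)%N, forall k, S (rep k) &
        forall z, S z -> exists k, enorm (z - rep k) <= d%:R * w].
Proof.
move=> w0 SM MN; case: N => [|N] in MN *.
  exists void, (fun k : void => match k with end).
  split=> // [|z /SM zM]; first by rewrite card_void.
  by have := enorm_ge0 z; move: MN; rewrite mul0r; lra.
pose idx (z : 'rV[R]_d) i := Num.truncn ((z ord0 i + M) / w).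
pose cell (z : 'rV[R]_d) : {ffun 'I_d -> 'I_N.+1} := [ffun i => inord (idx z i)].
have idxP z i : S z -> (idx z i < N.+1)%N /\
    (idx z i)%:R * w <= z ord0 i + M < (idx z i).+1%:R * w.
  move=> Sz; have := le_trans (entry_le_enorm z i) (SM z Sz).
  rewrite ler_norml => /andP[zl zu].
  have q0 : 0 <= (z ord0 i + M) / w by apply: divr_ge0; [lra|exact: ltW].
  have /andP[t1 t2] := truncn_itv q0.
  split; last by rewrite -ler_pdivlMr// t1 -ltr_pdivrMr.
  rewrite /idx truncn_lt_nat// ltr_pdivrMr//; apply: le_lt_trans MN.
  by rewrite mulr2n lerD2r.
pose P := [pred k | `[< exists2 z, S z & cell z = k >]].
have repP (k : {k | P k}) : {z | S z /\ cell z = val k}.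
  by apply: cid; have /asboolP[z Sz zk] := valP k; exists z.
exists {k | P k}, (fun k => sval (repP k)); split.
- by rewrite card_sig (leq_trans (max_card _))// card_ffun !card_ord.
- by move=> k; case: (svalP (repP k)).
move=> z Sz; have Pz : P (cell z) by apply/asboolP; exists z.
pose k : {k | P k} := exist (fun x => P x) (cell z) Pz.
exists k; have [Sr /= rz] := svalP (repP k).
set r := sval _ in Sr rz *.
apply: enorm_le_entries => [|i]; first exact: ltW.
have [zN /andP[z1 z2]] := idxP _ i Sz; have [rN /andP[r1 r2]] := idxP _ i Sr.
have E : idx r i = idx z i.
  by have /ffunP/(_ i)/(congr1 (@nat_of_ord _)) := rz; rewrite !ffunE !inordK.
rewrite E in r1 r2; rewrite !mxE ler_norml.
by move: z2 r2; rewrite -natr1 mulrDl mul1r => z2 r2; apply/andP; split; lra.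
Qed.

Lemma bernoulli_ineq (R : realType) (x : R) n : 0 <= x <= 1 ->
  1 - n%:R * x <= (1 - x) ^+ n.
Proof.
move=> /andP[x0 x1]; elim: n => [|n IHn]; first by rewrite mul0r subr0 expr0.
have : 0 <= n%:R :> R by rewrite ler0n.
rewrite exprS -natr1; set y := (1 - x) ^+ n in IHn *; set m : R := n%:R.
by move=> m0; have : (1 - x) * (1 - m * x) <= (1 - x) * y; [rewrite ler_wpM2l//; lra|nra].
Qed.

Section density.
Context {R : realType} {d : nat}.
Variable f0 : 'rV[R]_d -> R.
Hypotheses (f0_ge0 : forall x, 0 <= f0 x) (f0_cont : continuous f0).
Hypothesis f0_int : leb_int (fun x => (f0 x)%:E) = 1%E.
Local Notation leb := (@titer R R (fun h : R -> \bar R => (\int[@lebesgue_measure R]_x h x)%E) d).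

Definition prob_of_density (h : d.-tuple R -> \bar R) : \bar R :=
  leb (fun t => ((f0 (row_of_tuple t))%:E * h t)%E).
Local Notation P := prob_of_density.

Let mf0 : measurable_fun setT (fun t : d.-tuple R => (f0 (row_of_tuple t))%:E).
Proof. by apply/measurable_EFinP; exact: (measurable_continuous_row f0_cont). Qed.

Lemma nonneg_integral_prob : nonneg_integral P.
Proof.
apply: nonneg_integral_density => //; first by move=> x; rewrite lee_fin.
exact: nonneg_integral_titer (@nonneg_integral_lebesgue R).
Qed.

Lemma prob1 : P (fun=> 1%:E) = 1%:E.
Proof.
by rewrite -[RHS]f0_int; congr (leb _); apply/funext => t; rewrite mule1.
Qed.

Lemma prob_setC_le (A : set (d.-tuple R)) (q : R) : measurable A ->
  (q%:E <= P (fun t => (\1_A t)%:E))%E ->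
  (P (fun t => (\1_(~` A) t)%:E) <= (1 - q)%:E)%E.
Proof.
move=> mA qA; have nP := nonneg_integral_prob.
have mA' := measurable_indic_EFin mA.
have mC := measurable_indic_EFin (measurableC mA).
have : (P (fun t => (\1_A t)%:E) + P (fun t => (\1_(~` A) t)%:E) = 1%:E)%E.
  rewrite -(nni_D nP)// -prob1; congr P; apply/funext => t.
  by rewrite -EFinD !indicE in_setC; case: (t \in A); rewrite ?addr0 ?add0r.
move=> E; rewrite EFinB -E leeBrDr//.
by rewrite addeC leeD2r.
Qed.

Lemma prob_row_ball (z : 'rV[R]_d) (r c : R) : (0 < d)%N -> 0 < r -> 0 <= c ->
  (forall y, enorm (y - z) <= r -> c <= f0 y) ->
  ((c * (r ^+ d * unit_ball_vol R d))%:E <= P (fun t => (\1_(row_ball z r) t)%:E))%E.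
Proof.
move=> d0 r0 c0 cf; have [_ vE] := @unit_ball_vol_gt0 R d d0.
have nleb : nonneg_integral leb := nonneg_integral_titer _ (@nonneg_integral_lebesgue R).
have mb := measurable_indic_EFin (measurable_row_ball z r).
rewrite !EFinM -vE -(leb_row_ball z r0) -(nni_Z nleb)//.
apply: (nni_le nleb).
- exact: emeasurable_funM.
- exact: emeasurable_funM.
- by move=> t; rewrite mule_ge0.
- move=> t; rewrite -!EFinM lee_fin indicE.
  by have [/set_mem/cf h|_] := boolP (t \in _); rewrite ?mulr1 ?mulr0.
Qed.

Lemma prob_band (e lam c : R) :
  (leb_int (fun x => (\1_[set y | (`|f0 y - lam| <= e)%R] x * f0 x)%:E) <= c%:E)%E ->
  (P (fun t => (\1_[set t | (`|f0 (row_of_tuple t) - lam| <= e)%R] t)%:E) <= c%:E)%E.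
Proof.
apply: le_trans; rewrite le_eqVlt; apply/orP; left; apply/eqP.
congr (leb _); apply/funext => t; rewrite -EFinM mulrC; congr (_ * _)%:E.
Qed.

End density.

Lemma ln2_ge_half (R : realType) : 2^-1 <= ln 2 :> R.
Proof.
have := @le_ln1Dx R (- 2^-1); rewrite (_ : 1 + - 2^-1 = 2^-1); last by lra.
by rewrite lnV ?posrE// lerN2; apply; lra.
Qed.

Lemma ln_nat_ge1 (R : realType) n : (4 <= n)%N -> 1 <= ln n%:R :> R.
Proof.
move=> n4; apply: (@le_trans _ _ (ln (2 ^+ 2))).
  by rewrite lnXn// mulr2n; have := @ln2_ge_half R; lra.
by rewrite ler_ln ?posrE ?exprn_gt0 ?ltr0n ?(leq_trans _ n4)// -natrX ler_nat.
Qed.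

Section radius.
Context {R : realType} {d n : nat} {lam : R}.
Hypotheses (d0 : (0 < d)%N) (n2 : (2 <= n)%N) (lam0 : 0 < lam).

Let v0 : 0 < unit_ball_vol R d.
Proof. by have [] := @unit_ball_vol_gt0 R d d0. Qed.
Let nR : 0 < n%:R :> R.
Proof. by rewrite ltr0n (leq_trans _ n2). Qed.
Let dR : 0 < d%:R :> R.
Proof. by rewrite ltr0n. Qed.

Lemma ln_nat_gt0 : 0 < ln n%:R :> R.
Proof. by rewrite ln_gt0// ltr1n. Qed.

Let X := 16 * d%:R * ln n%:R / (lam * unit_ball_vol R d * n%:R).
Let X0 : 0 < X.
Proof. by rewrite divr_gt0 ?mulr_gt0// ln_nat_gt0. Qed.

Lemma half_r_nE : r_n d n lam / 2 = powR X d%:R^-1.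
Proof. by rewrite /r_n mulrAC divff ?mul1r. Qed.

Lemma half_r_n_gt0 : 0 < r_n d n lam / 2.
Proof. by rewrite half_r_nE powR_gt0. Qed.

Lemma half_r_n_exp :
  (r_n d n lam / 2) ^+ d = 16 * d%:R * ln n%:R / (lam * unit_ball_vol R d * n%:R).
Proof.
rewrite half_r_nE -powR_mulrn ?powR_ge0// -powRrM mulVf ?gt_eqF//.
by rewrite powRr1// ltW.
Qed.

Lemma half_r_n_ge (c : R) : (16 <= n)%N -> 0 <= c <= 1 ->
  c <= 16 * d%:R / (lam * unit_ball_vol R d) -> c / n%:R <= r_n d n lam / 2.
Proof.
move=> n16 /andP[c0 c1] cA.
have ln1 : 1 <= ln n%:R :> R by rewrite ln_nat_ge1// (leq_trans _ n16).
have cn1 : c / n%:R <= 1.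
  by rewrite ler_pdivrMr// mul1r (le_trans c1)// ler1n (leq_trans _ n2).
have cn0 : 0 <= c / n%:R by rewrite divr_ge0// ltW.
rewrite -(@ler_pXn2r _ d)// ?nnegrE ?(ltW half_r_n_gt0)// half_r_n_exp.
apply: (@le_trans _ _ (c / n%:R)).
  by rewrite -[leRHS]expr1 ler_wiXn2l.
rewrite invfM mulrA ler_pM2r ?invr_gt0//; apply: le_trans cA _.
rewrite ler_pM2r ?invr_gt0 ?mulr_gt0// ler_pMr// mulr_gt0//.
Qed.

End radius.

Lemma good_event (R : realType) d (f0 : 'rV[R]_d -> R) (lam M C epsb : R) n :
  (0 < d)%N -> 0 < lam -> (forall x, 0 <= f0 x) -> continuous f0 ->
  leb_int (fun x => (f0 x)%:E) = 1%E ->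
  0 < C ->
  0 < epsb ->
  (forall eps : R, 0 < eps < epsb ->
    (leb_int (fun x => (\1_[set y | (`|f0 y - lam| <= eps)%R] x * f0 x)%:E)
      <= (C * eps)%:E)%E) ->
  (2 <= n)%N -> 0 <= M ->
  (forall z, lam <= f0 z -> enorm z <= M) ->
  (forall z y, lam <= f0 z -> enorm (y - z) <= r_n d n lam / 2 -> lam / 2 <= f0 y) ->
  d%:R * ((M *+ 2 + 1) / n%:R ^+ 2) < (r_n d n lam / 2) / (2 * d%:R) ->
  exists G : set (n.-tuple (d.-tuple R)), measurable G /\
    ((1 - (1 + n%:R) / n%:R ^+ 2)%:E <= sample_int f0 (fun s => (\1_G s)%:E))%E /\
    forall s, G s ->
      let xs := fun i : 'I_n => row_of_tuple (tnth s i) in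
      (forall z, lam <= f0 z -> exists i, enorm (z - xs i) < r_n d n lam / 2) /\
      (forall l : 'I_n, let e := epsb * l.+1%:R / n.+1%:R in
        (2 : R) ^+ #|[pred i | `|f0 (xs i) - lam| <= e]| < n%:R ^+ 2 * (1 + C * e) ^+ n).
Proof.
move=> d0 lam0 f0_ge0 cf f0_int C0 epsb0 band n2 M0 SM Shalf spacing.
have [v0 _] := @unit_ball_vol_gt0 R d d0.
have nR : 0 < n%:R :> R by rewrite ltr0n (leq_trans _ n2).
have dR : 0 < d%:R :> R by rewrite ltr0n.
have rho0 := @half_r_n_gt0 R d n lam d0 n2 lam0.
have rhoE := @half_r_n_exp R d n lam d0 n2 lam0.
set rho := r_n d n lam / 2 in spacing Shalf rho0 rhoE *.
have w0 : 0 < (M *+ 2 + 1) / n%:R ^+ 2.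
  by rewrite divr_gt0 ?exprn_gt0// ltr_wpDl// mulrn_wge0.
have Mw : M *+ 2 < (n ^ 2)%:R * ((M *+ 2 + 1) / n%:R ^+ 2).
  by rewrite natrX mulrC divfK ?ltrDl// expf_neq0// gt_eqF.
have [K [rep [cardK repS net]]] := finite_net w0 SM Mw.
pose h : R := (2 * d%:R)^-1.
have hE : d%:R * h = 2^-1 by rewrite /h invfM mulrCA divff ?mulr1// gt_eqF.
have h0 : 0 < h by rewrite invr_gt0 mulr_gt0.
have h1 : h <= 2^-1 by rewrite -hE ler_peMl ?(ltW h0) ?ler1n.
pose r := (1 - h) * rho.
have r0 : 0 < r by rewrite mulr_gt0//; lra.
pose e (l : 'I_n) : R := epsb * l.+1%:R / n.+1%:R.
have e0 l : 0 < e l by rewrite divr_gt0 ?mulr_gt0.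
have eb l : e l < epsb.
  by rewrite /e -mulrA gtr_pMr// ltr_pdivrMr// mul1r ltr_nat ltnS.
pose B k := row_ball (rep k) r.
pose A l : set (d.-tuple R) := [set t | `|f0 (row_of_tuple t) - lam| <= e l].
pose p : R := 4 * d%:R * ln n%:R / n%:R.
have BP k : (p%:E <= prob_of_density f0 (fun t => (\1_(B k) t)%:E))%E.
  have lam20 : 0 <= lam / 2 by rewrite divr_ge0// ltW.
  apply: (@le_trans _ _ (lam / 2 * (r ^+ d * unit_ball_vol R d))%:E); last first.
    apply: prob_row_ball => // y yr; apply: (Shalf (rep k)) => //.
    by apply: le_trans yr _; rewrite /r ler_piMl ?(ltW rho0)//; lra.
  rewrite lee_fin /p exprMn rhoE.
  have hd : 2^-1 <= (1 - h) ^+ d.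
    have h01 : 0 <= h <= 1 by apply/andP; split; lra.
    by apply: le_trans (bernoulli_ineq d h01); lra.
  have l0 := @ln_nat_gt0 R n n2.
  have -> : lam / 2 * ((1 - h) ^+ d *
      (16 * d%:R * ln n%:R / (lam * unit_ball_vol R d * n%:R)) * unit_ball_vol R d)
      = (1 - h) ^+ d * 2 * (4 * d%:R * ln n%:R / n%:R).
    by field; rewrite !gt_eqF.
  by rewrite ler_peMl; [|rewrite !mulr_ge0 ?invr_ge0 ?ltW|lra].
have nP := nonneg_integral_prob f0_ge0 cf.
have mB k : measurable (B k) by exact: measurable_row_ball.
have mA l : measurable (A l).
  rewrite -[X in measurable X]setTI.
  apply: (measurable_fun_ler (f := fun t => `|f0 (row_of_tuple t) - lam|)
    (g := fun=> e l)) => //.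
  apply: measurableT_comp => //; apply: measurable_funB => //.
  exact: (measurable_continuous_row cf).
have BC k : (prob_of_density f0 (fun t => (\1_(~` B k) t)%:E) <= (expR (- p))%:E)%E.
  apply: le_trans (prob_setC_le f0_ge0 cf f0_int (mB k) (BP k)) _.
  by rewrite lee_fin; exact: expR_ge1Dx.
have AP l : (prob_of_density f0 (fun t => (\1_(A l) t)%:E) <= (C * e l)%:E)%E.
  by apply: prob_band; apply: band; rewrite e0 eb.
have Ce0 l : 0 <= C * e l by rewrite mulr_ge0// ltW.
have [|G [mG [PG GP]]] := sampling_event nP (n := n) _ (prob1 f0_int) mB mA BC Ce0 AP.
  exact: leq_trans n2.
exists G; split=> //; split=> [|s Gs xs].
  apply: le_trans PG; rewrite lee_fin lerB// mulrDl lerD2r mul1r.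
  rewrite -expRM_natr mulNr divfK ?gt_eqF// expRN -natrM expRM_natl lnK ?posrE//.
  rewrite ler_pdivrMr ?exprn_gt0// mulrC ler_pdivlMr ?exprn_gt0// -!natrX -natrM ler_nat.
  apply: (leq_trans (leq_mul cardK (leqnn _))); rewrite -expnM -expnD.
  rewrite leq_pexp2l ?(leq_trans _ n2)// -[4%N]/(2 + 2)%N mulnDl leq_add2l.
  by rewrite -{1}[2%N]muln1 leq_mul2l.
have [Gball Gband] := GP _ Gs; split=> [z Sz|l].
  have [k zk] := net z Sz; have [i Bi] := Gball k; exists i.
  have := enorm_triangle (rep k) z (xs i); rewrite (enormB (rep k)).
  by move: Bi; rewrite /B /row_ball/= -/(xs i) /r; move: spacing; rewrite -/h; nra.
apply: le_lt_trans (Gband l); rewrite ler_eXn2l ?ltr1n//.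
apply/subset_leq_card/fintype.subsetP => i; rewrite !inE => ei.
exact: ei.
Qed.

Lemma count_le (R : realType) (N n : nat) (p : R) : (0 < n)%N -> 0 <= p ->
  2 ^+ N < n%:R ^+ 2 * (1 + p) ^+ n -> N%:R <= 4 * ln n%:R + 2 * n%:R * p.
Proof.
move=> n0 p0 Nlt; have nR : 0 < n%:R :> R by rewrite ltr0n.
have p1 : 0 < 1 + p by rewrite ltr_wpDr.
have : ln (2 ^+ N) <= ln (n%:R ^+ 2 * (1 + p) ^+ n).
  by rewrite ler_ln ?posrE ?mulr_gt0 ?exprn_gt0// ltW.
rewrite lnM ?posrE ?exprn_gt0// !lnXn// -[X in X <= _]mulr_natl -[X in _ + X]mulr_natl.
have := @le_ln1Dx R p; rewrite (lt_le_trans _ p0) ?ltrN10// => /(_ isT) lnp.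
have : n%:R * ln (1 + p) <= n%:R * p by rewrite ler_pM2l.
have : N%:R * 2^-1 <= N%:R * ln 2 :> R by rewrite ler_wpM2l// ln2_ge_half.
lra.
Qed.

Lemma sqrt_ln_ratio (R : realType) (n : nat) : (16 <= n)%N ->
  ln n%:R / n%:R <= Num.sqrt (ln n%:R / n%:R) :> R /\
  n%:R^-1 <= Num.sqrt (ln n%:R / n%:R) :> R.
Proof.
move=> n16; have nR : 0 < n%:R :> R by rewrite ltr0n (leq_trans _ n16).
have ln1 : 1 <= ln n%:R :> R by rewrite ln_nat_ge1// (leq_trans _ n16).
set q := ln n%:R / n%:R.
have q0 : 0 <= q by rewrite divr_ge0// ?(ltW nR)// (le_trans ler01).
have q1 : q <= 1 by rewrite ler_pdivrMr// mul1r ltW// ln_sublinear.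
have qs : q <= Num.sqrt q.
  rewrite -{1}(sqr_sqrtr q0) -[leRHS]expr1 ler_wiXn2l ?sqrtr_ge0//.
  by rewrite -sqrtr1 ler_sqrt.
split=> //; apply: le_trans qs; rewrite /q -[leLHS]mul1r ler_pM2r ?invr_gt0//.
Qed.

Theorem theorem3 (R : realType) (d : nat) (lam : R) (f0 : 'rV[R]_d -> R)
  (alpha : R) :
  (0 < d)%N -> 0 < lam ->
  (* f0 is a probability density on R^d *)
  (forall x, 0 <= f0 x) ->
  leb_int (fun x => (f0 x)%:E) = 1%E ->
  (* (i) *)
  continuous f0 ->
  (forall eps : R, 0 < eps -> exists M : R,
      forall x, M < enorm x -> `|f0 x| < eps) ->
  (* (ii) and (iii) *)
  (exists C epsb : R, 0 < C /\ 0 < epsb /\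
     (forall eps : R, 0 < eps < epsb ->
        (leb_int (fun x => (\1_[set y | `|f0 y - lam| <= eps] x * f0 x)%:E)
          <= (C * eps)%:E)%E) /\
     (forall laml lamh : R,
        lam - epsb <= laml -> laml < lamh -> lamh <= lam + epsb ->
        forall x y, level_set f0 lamh x -> level_set f0 lamh y ->
          (~ connected_component (level_set f0 lamh) x y ->
             ~ connected_component (level_set f0 laml) x y) /\
          (connected_component (level_set f0 laml) x y ->
             connected_component (level_set f0 lamh) x y))) ->
  (* alpha-Hoelder continuity *)
  0 < alpha <= 1 ->
  (exists K : R, forall x y, `|f0 x - f0 y| <= K * powR (enorm (x - y)) alpha) ->
  exists C0 deltab gammab : R, 0 < C0 /\ 0 < deltab /\ 0 < gammab /\
    forall (n : nat) (a m : R), (16 <= n)%N ->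
      0 < a <= 1 -> 0 < m <= 1 -> a <= 2 * m ->
      exists G : set (n.-tuple (d.-tuple R)), measurable G /\
        ((1 - (1 + n%:R) / n%:R ^+ 2)%:E
           <= sample_int f0 (fun s => (\1_G s)%:E))%E /\
        forall s, G s ->
          let xs := fun i : 'I_n => row_of_tuple (tnth s i) in
          forall delta gamma : R,
            r_n d n lam <= delta -> delta < deltab ->
            0 < gamma -> gamma < gammab ->
            forall f : 'rV[R]_d -> R, (forall x, `|f x - f0 x| <= gamma) ->
              D_loss m a f f0 lam delta xs
                <= C0 * (Num.max gamma (powR delta alpha)
                         + Num.sqrt (ln n%:R / n%:R)).
Proof.
move=> d0 lam0 f0_ge0 f0_int cf vanish [C [epsb [C0 [epsb0 [band persist]]]]].
move=> /andP[alpha0 alpha1] [K' holder'].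
have [M0 SM0] := vanish lam lam0.
pose M := `|M0|; have M_ge0 : 0 <= M by exact: normr_ge0.
have SM z : lam <= f0 z -> enorm z <= M.
  move=> fz; apply: contrapT => /negP; rewrite -ltNge => zM.
  have /SM0 : M0 < enorm z by apply: le_lt_trans zM; exact: ler_norm.
  by rewrite ger0_norm// ltNge fz.
pose K := `|K'| + 1; have K0 : 0 < K by rewrite ltr_wpDl.
have holder x y : `|f0 x - f0 y| <= K * powR (enorm (x - y)) alpha.
  apply: le_trans (holder' x y) _; rewrite ler_wpM2r ?powR_ge0//.
  by rewrite /K ler_wpDr// ler_norm.
have [v0 _] := @unit_ball_vol_gt0 R d d0.
have dR : 0 < d%:R :> R by rewrite ltr0n.
pose A := 16 * d%:R / (lam * unit_ball_vol R d).
have A0 : 0 < A by rewrite divr_gt0 ?mulr_gt0.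
pose c := Num.min 1 A.
have c0 : 0 < c by rewrite lt_min ltr01.
have c1 : c <= 1 by rewrite ge_min lexx.
have cA : c <= A by rewrite ge_min lexx orbT.
pose n0 : R := 2 * d%:R ^+ 2 * (M *+ 2 + 1) / c.
have M1 : 0 < M *+ 2 + 1 by rewrite ltr_wpDl ?mulrn_wge0.
have n00 : 0 < n0 by rewrite divr_gt0// mulr_gt0// mulr_gt0// exprn_gt0.
pose tol := Num.min (lam / 2) (epsb / 4).
have tol0 : 0 < tol by rewrite lt_min; apply/andP; split; exact: divr_gt0.
pose deltab := Num.min (2 * c / n0) (powR (tol / K) alpha^-1).
have deltab0 : 0 < deltab.
  rewrite lt_min; apply/andP; split; first by rewrite divr_gt0// mulr_gt0.
  by rewrite powR_gt0// divr_gt0.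
have small (t : R) : 0 <= t -> t <= deltab -> K * powR t alpha <= tol.
  move=> t0; rewrite le_min => /andP[_ td].
  rewrite -ler_pdivlMl// mulrC.
  have -> : tol / K = powR (powR (tol / K) alpha^-1) alpha.
    by rewrite -powRrM mulVf ?gt_eqF// powRr1// ltW// divr_gt0.
  by apply: ge0_ler_powR; rewrite ?nnegrE ?powR_ge0// ltW.
exists (64 + 32 * C * (1 + K) + 32 * C * epsb), deltab, (epsb / 4).
split; [|split=> //; split; first exact: divr_gt0].
  by rewrite !addr_gt0// !mulr_gt0// addr_gt0.
move=> n a m n16 a01 m01 _.
have n2 : (2 <= n)%N by rewrite (leq_trans _ n16).
have nR : 0 < n%:R :> R by rewrite ltr0n (leq_trans _ n2).
have rho0 := @half_r_n_gt0 R d n lam d0 n2 lam0.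
have nP := nonneg_integral_prob f0_ge0 cf.
have [rlarge|rsmall] := leP deltab (r_n d n lam).
  exists setT; split; [exact: measurableT|split].
    rewrite [X in sample_int _ X](_ : _ = fun=> 1%:E); last first.
      by apply/funext => s; rewrite indicT.
    rewrite -[sample_int f0 _]/(titer (prob_of_density f0) _) titer1//; last exact: prob1.
    by rewrite lee_fin lerBlDr lerDl divr_ge0 ?addr_ge0.
  by move=> s _ xs delta gamma r1 /(le_lt_trans r1); rewrite ltNge rlarge.
have rhoc : c / n%:R <= r_n d n lam / 2.
  by apply: half_r_n_ge => //; rewrite (ltW c0) c1.
have nbig : n0 < n%:R.
  have : 2 * (c / n%:R) < 2 * (c / n0).
    have : r_n d n lam < 2 * c / n0 by apply: (lt_le_trans rsmall); rewrite ge_min lexx.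
    by rewrite -mulrA; lra.
  by rewrite ltr_pM2l// ltr_pM2l// ltf_pV2.
have [||G [mG [PG GP]]] :=
    good_event d0 lam0 f0_ge0 cf f0_int C0 epsb0 band n2 M_ge0 SM.
- move=> z y fz zy.
  have /andP[t1 _] : (tol <= lam / 2) && (tol <= epsb / 4) by rewrite -le_min.
  have := small (r_n d n lam / 2) (ltW rho0).
  have -> : r_n d n lam / 2 <= deltab by move: rho0; lra.
  move=> /(_ isT) h1; have := holder z y.
  have : powR (enorm (z - y)) alpha <= powR (r_n d n lam / 2) alpha.
    by rewrite enormB; apply: ge0_ler_powR; rewrite ?nnegrE ?enorm_ge0// ltW.
  rewrite -(ler_pM2l K0) => h2 h3.
  by have := ler_norm (f0 z - f0 y); lra.
- rewrite ltr_pdivlMr ?mulr_gt0//; apply: lt_le_trans rhoc.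
  have -> : d%:R * ((M *+ 2 + 1) / n%:R ^+ 2) * (2 * d%:R) = n0 / n%:R * (c / n%:R).
    by rewrite /n0; field; rewrite !gt_eqF.
  by rewrite gtr_pMl ?divr_gt0// ltr_pdivrMr// mul1r.
exists G; split=> //; split=> // s Gs xs delta gamma rdel deldb gam0 gamb f ff0.
have [cover counts] := GP s Gs.
have del0 : 0 < delta by apply: lt_le_trans rdel; move: rho0; lra.
have Kdel := small delta (ltW del0) (ltW deldb).
have tole : tol <= epsb / 4 by rewrite ge_min lexx orbT.
have Kd0 : 0 < K * powR delta alpha by rewrite mulr_gt0// powR_gt0.
pose eps := gamma + K * powR delta alpha.
have persistent x y : level_set f0 (lam + eps) x -> level_set f0 (lam + eps) y ->
    connected_component (level_set f0 (lam - eps)) x y ->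
    connected_component (level_set f0 (lam + eps)) x y.
  move=> Sx Sy; apply: (persist _ _ _ _ _ x y Sx Sy).2; rewrite /eps; lra.
have cover' z : lam <= f0 z -> exists k, enorm (z - xs k) < delta / 2.
  move=> /cover[k zk]; exists k; apply: lt_le_trans zk _.
  by rewrite ler_pM2r ?invr_gt0.
have := D_loss_le_band alpha0 K0 del0 gam0 holder ff0 persistent cover' n2 a01 m01.
move=> /le_trans; apply.
pose k := Num.truncn (eps * n.+1%:R / epsb).
have eps0 : 0 < eps by rewrite addr_gt0.
have epsb2 : eps < epsb / 2 by rewrite /eps; lra.
have q0 : 0 <= eps * n.+1%:R / epsb by rewrite divr_ge0 ?mulr_ge0// ltW.
have n1E : n.+1%:R = n%:R + 1 :> R by rewrite -natr1.
have n1R : 1 <= n%:R :> R by rewrite ler1n (leq_trans _ n2).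
have kn : (k < n)%N.
  rewrite /k truncn_lt_nat// ltr_pdivrMr// n1E; nra.
have /andP[k1 k2] := truncn_itv q0; rewrite -/k in k1 k2.
pose e := epsb * k.+1%:R / n.+1%:R.
have e_ge : eps <= e.
  by rewrite /e ler_pdivlMr// mulrC [leRHS]mulrC -ler_pdivrMr// mulrC ltW.
have e_le : e <= eps + epsb / n%:R.
  move: k1; rewrite ler_pdivlMr// => k1.
  have nn : epsb <= epsb / n%:R * n.+1%:R.
    by rewrite -mulrAC ler_pdivlMr// ler_pM2l// ler_nat.
  by rewrite /e ler_pdivrMr// -natr1 mulrDr mulr1 mulrDl lerD// mulrC.
have e0 : 0 <= e by rewrite (le_trans _ e_ge)// ltW.
have := counts (Ordinal kn); rewrite /= -/e => /count_le cnt.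
have {}cnt := cnt (leq_trans (isT : 0 < 16)%N n16) (mulr_ge0 (ltW C0) e0).
set N := #|_|%:R; set q := Num.sqrt _; set mx := Num.max _ _.
have NN : N <= 4 * ln n%:R + 2 * n%:R * (C * e).
  apply: le_trans cnt; rewrite ler_nat; apply/subset_leq_card/fintype.subsetP => i.
  by rewrite !unfold_in /= => h; exact: le_trans h e_ge.
have [q1 q2] := @sqrt_ln_ratio R n n16; rewrite -/q in q1 q2.
have gmx : gamma <= mx by rewrite le_max lexx.
have dmx : powR delta alpha <= mx by rewrite le_max lexx orbT.
have Nn : N / n%:R <= 4 * q + 2 * (C * e).
  rewrite ler_pdivrMr//; apply: le_trans NN _.
  by move: q1; rewrite ler_pdivrMr//; lra.
have e_mx : e <= (1 + K) * mx + epsb * q.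
  apply: le_trans e_le _; apply: lerD; last by rewrite ler_pM2l.
  by rewrite mulrDl mul1r lerD// ler_pM2l.
have : C * e <= C * ((1 + K) * mx + epsb * q) by rewrite ler_pM2l.
have mx0 : 0 <= mx by rewrite (le_trans _ gmx)// ltW.
have qq0 : 0 <= q by exact: sqrtr_ge0.
rewrite -mulrA => Ce.
have : 0 <= C * (1 + K) * q by rewrite !mulr_ge0// ltW// addr_gt0.
have : 0 <= C * epsb * mx by rewrite !mulr_ge0// ltW.
by move: Nn Ce; rewrite -[16 * _]/(16 * (N / n%:R)); nra.
Qed.
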